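(* Let $Y$ be an infinite dimensional real Hilbert space, let $A:\ell^2\to Y$ be an injective bounded linear operator with non-closed range, let $x^\dagger\in\ell^1$ and $y=Ax^\dagger$, and assume that for each $k\in\mathbb{N}$ there is $f^{(k)}\in Y$ with $e^{(k)}=A^*f^{(k)}$. Fix $\eta>0$ arbitrarily, and put $$\mathcal{R}_\eta(x):=\eta\|x\|_{\ell^1}+\tfrac12\|x\|_{\ell^2}^2,\qquad E_\eta(x,x^\dagger):=\eta\,\|x-x^\dagger\|_{\ell^1}+\tfrac14\|x-x^\dagger\|_{\ell^2}^2 .$$ Let $$g_\eta(t):=2\eta\,\varphi(t)+K\,\psi(t),\qquad t>0,$$ where $\varphi(t)=\inf_{n\in\mathbb{N}}\big(\sum_{k=n+1}^\infty|x^\dagger_k|+t\sum_{k=1}^n\|f^{(k)}\|_Y\big)$, and where: if $x^\dagger\in\ell^1\setminus\mathrm{range}(A^* )$, then $K=2$ and $\psi$ is a concave index function with $\psi(t)\ge\widehat\psi(t)$ for all $t>0$ ($\widehat\psi$ as defined in the context); if $x^\dagger\in\ell^1\cap\mathrm{range}(A^* )$, then $\psi(t)=t$ and $K=R_0$, where $R_0>0$ satisfies $d^{A^*}_{x^\dagger}(R_0)=0$. Then $g_\eta$ is a concave index function and the variational inequality $$E_\eta(x,x^\dagger)\le\mathcal{R}_\eta(x)-\mathcal{R}_\eta(x^\dagger)+g_\eta\big(\|A(x-x^\dagger)\|_Y\big)\qquad\text{for all }x\in\ell^1$$ holds. Moreover, for data $y^\delta\in Y$ with $\|y-y^\delta\|_Y\le\delta$,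 let $x^\delta_{\beta,\eta}$ denote the minimizer over $x\in\ell^1$ of $\frac12\|Ax-y^\delta\|_Y^2+\beta\,\mathcal{R}_\eta(x)$ ($\beta>0$). If the regularization parameter $\beta_*=\beta_*(\delta,y^\delta)$ is chosen by the two-sided discrepancy principle (TDP), by the sequential discrepancy principle (SDP), or by the adapted Lepskii principle (LEP) (all described in the context), then $$E_\eta(x^\delta_{\beta_*,\eta},x^\dagger)=\mathcal{O}(g_\eta(\delta))\quad\text{as }\delta\to0,$$ and consequently $$\|x^\delta_{\beta_*,\eta}-x^\dagger\|_{\ell^2}\le\|x^\delta_{\beta_*,\eta}-x^\dagger\|_{\ell^1}=\mathcal{O}(\varphi(\delta)+\psi(\delta))\quad\text{as }\delta\to0 .$$
   Context: Sequence spaces are real and indexed by $k\in\mathbb{N}=\{1,2,\dots\}$; $e^{(k)}$ is the $k$-th standard unit vector; $A^*:Y\to\ell^2$ is the Hilbert space adjoint of $A:\ell^2\to Y$. Index function: a function $g:(0,\infty)\to(0,\infty)$ that is continuous, strictly increasing, with $\lim_{t\to0^+}g(t)=0$; it is extended by $g(0)=0$. Distance function: $d^{A^*}_{x^\dagger}(R):=\inf\{\|x^\dagger-A^*v\|_{\ell^2}:\ v\in Y,\ \|v\|_Y\le R\}$ for $R>0$. If $x^\dagger\notin\mathrm{range}(A^* )$, set $\Phi(R):=[d^{A^*}_{x^\dagger}(R)]^2/R$ for $R>0$; this is continuous and strictly decreasing with $\Phi(R)\to+\infty$ as $R\to0$ and $\Phi(R)\to0$ as $R\to\infty$. Set $\widehat\psi(t):=[d^{A^*}_{x^\dagger}(\Phi^{-1}(t))]^2$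 for $t>0$ (an index function). If $x^\dagger\in\mathrm{range}(A^* )$, there is always $R_0>0$ with $d^{A^*}_{x^\dagger}(R_0)=0$. Parameter choices, for noise level $\delta>0$ and data $y^\delta$ (the parameter is assumed to exist; write $x_\beta:=x^\delta_{\beta,\eta}$): - TDP, with prescribed $1\le\tau_1\le\tau_2<\infty$: $\beta_*>0$ is such that $\tau_1\delta\le\|Ax_{\beta_*}-y^\delta\|_Y\le\tau_2\delta$. - SDP, with prescribed $\tau>1$, $0<q<1$, $\beta_0>0$: $\beta_*\in\{q^j\beta_0: j=0,1,2,\dots\}$ is such that $\|Ax_{\beta_*}-y^\delta\|_Y\le\tau\delta<\|Ax_{\beta_*/q}-y^\delta\|_Y$. - LEP, with prescribed $0<q<1$ and $\beta_0>0$, where $\beta_0$ (possibly depending on $\delta$) is small enough that $E_\eta(x_{\beta_0},x^\dagger)\le\Theta(\beta_0)$, with $\Theta(\beta):=\frac{17\delta^2}{2\beta}$: let $\widetilde\Delta_q:=\{\beta_0/q^j: j=0,1,2,\dots\}$; $\beta_*$ is the largest $\beta\in\widetilde\Delta_q$ such that $E_\eta(x_{\beta'},x_\beta)\le 2C_E\,\Theta(\beta')$ for all $\beta'\in\widetilde\Delta_q$ with $\beta_0\le\beta'<\beta$. Here $E_\eta(x,z)=\eta\|x-z\|_{\ell^1}+\frac14\|x-z\|^2_{\ell^2}$ and $C_E=2$ is a constant for which $E_\eta(x^{(1)},x^{(2)})\le C_E(E_\eta(x^{(1)},x^{(3)})+E_\eta(x^{(3)},x^{(2)}))$ holds. *)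

(* Defs.v *)
From HB Require Import structures.
From mathcomp Require Import all_boot all_order all_algebra.
From mathcomp Require Import sesquilinear.
From mathcomp Require Import all_classical all_reals all_analysis.
From mathcomp Require Import ring lra.

Set Implicit Arguments.
Unset Strict Implicit.
Unset Printing Implicit Defensive.

Import Order.TTheory GRing.Theory Num.Theory.
Import numFieldNormedType.Exports.

Local Open Scope classical_set_scope.
Local Open Scope ring_scope.

(* The library provides this notation in ereal_scope only. *)
Notation "\sum_ ( m <= i '<oo' ) F" :=
  (\big[+%R/0%R]_(m <= i <oo) F%R) : ring_scope.

(* Sequences are indexed from 0: entry k of the code is entry k + 1 of the
   mathematical sequence. *)

Definition ell1 (R : realType) (u : nat -> R) : Prop :=
  cvgn (series (fun k => `|u k|)).

Definition ell1_norm (R : realType) (u : nat -> R) : R :=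
  \sum_(0 <= k <oo) `|u k|.

Definition square_summable (R : realType) : {pred nat -> R} :=
  fun u => `[< cvgn (series (fun k => u k ^+ 2)) >].
Arguments square_summable R : clear implicits.

Section square_sums.
Variable R : realType.
Implicit Types u v : nat -> R.

Lemma nneg_series_cvg u (M : R) : (forall k, 0 <= u k) ->
  (forall n, series u n <= M) -> cvgn (series u).
Proof.
move=> u0 uM; apply: nondecreasing_is_cvgn.
  by apply: nondecreasing_series => k _ _.
by exists M => _ [n _ <-].
Qed.

Lemma nneg_series_le u n : (forall k, 0 <= u k) -> cvgn (series u) ->
  series u n <= \sum_(0 <= k <oo) u k.
Proof.
move=> u0 cu; apply: (nondecreasing_cvgn_le _ cu n).
by apply: nondecreasing_series => k _ _.
Qed.

Lemma square_sum_ge0 u : 0 <= \sum_(0 <= k <oo) u k ^+ 2.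
Proof.
have [cu|ncu] := pselect (cvgn (series (fun k => u k ^+ 2))).
  have := nneg_series_le 0 (fun k => sqr_ge0 (u k)) cu.
  by rewrite /series/= big_geq.
by rewrite (dvgP ncu).
Qed.

Lemma ell1_square_summable u : ell1 u -> u \in square_summable R.
Proof.
move=> cu; apply/asboolP.
apply: (@nneg_series_cvg _ (ell1_norm u ^+ 2)) => [k|n]; first exact: sqr_ge0.
have le_s := nneg_series_le _ (fun k => normr_ge0 (u k)) cu.
apply: (@le_trans _ _ (series (fun k => `|u k|) n ^+ 2)); last first.
  rewrite ler_sqr ?nnegrE ?le_s//; first by apply: sumr_ge0.
  by apply: le_trans (le_s n); apply: sumr_ge0.
elim: n => [|n IH]; first by rewrite /series/= !big_geq// expr0n.
rewrite /series/= in IH *; rewrite !big_nat_recr//=.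
set S := \sum_(0 <= k < n) `|u k| in IH *.
have S0 : 0 <= S by apply: sumr_ge0.
have := mulr_ge0 S0 (normr_ge0 (u n)).
by rewrite -(real_normK (num_real (u n))); nra.
Qed.

Lemma square_summable_submod : submod_closed (square_summable R).
Proof.
split.
  apply/asboolP; apply: (@nneg_series_cvg _ 0) => [k|n]; first exact: sqr_ge0.
  by rewrite /series/= big1// => k _; rewrite [X in X ^+ 2]/= expr0n.
move=> a u v /asboolP cu /asboolP cv; apply/asboolP.
pose Su := \sum_(0 <= k <oo) u k ^+ 2; pose Sv := \sum_(0 <= k <oo) v k ^+ 2.
apply: (@nneg_series_cvg _ (2 * a ^+ 2 * Su + 2 * Sv)) => [k|n].
  exact: sqr_ge0.
have lu := nneg_series_le n (fun k => sqr_ge0 (u k)) cu.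
have lv := nneg_series_le n (fun k => sqr_ge0 (v k)) cv.
apply: (@le_trans _ _ (2 * a ^+ 2 * series (fun k => u k ^+ 2) n +
                       2 * series (fun k => v k ^+ 2) n)).
  rewrite /series/= !mulr_sumr -big_split/=; apply: ler_sum => k _.
  rewrite !fctE.
  have := sqr_ge0 (a * u k - v k); rewrite /GRing.scale/=; lra.
apply: lerD; last by rewrite ler_wpM2l.
by apply: ler_wpM2l => //; rewrite mulr_ge0// sqr_ge0.
Qed.

HB.instance Definition _ :=
  GRing.isSubmodClosed.Build R (nat -> R) (square_summable R) square_summable_submod.

End square_sums.

Record ell2 (R : realType) : Type := Ell2 {
  ell2_seq :> nat -> R;
  ell2_seqP : ell2_seq \in square_summable R
}.

HB.instance Definition _ (R : realType) := [isSub for @ell2_seq R].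
HB.instance Definition _ (R : realType) := [Choice of ell2 R by <:].
HB.instance Definition _ (R : realType) :=
  [SubChoice_isSubLmodule of ell2 R by <:].

Definition ell2_norm (R : realType) (x : ell2 R) : R :=
  Num.sqrt (\sum_(0 <= k <oo) x k ^+ 2).

Section ell2_normed.
Variable R : realType.
Implicit Types x z : ell2 R.

Lemma ell2_cvg x : cvgn (series (fun k => x k ^+ 2)).
Proof. by have /asboolP := ell2_seqP x. Qed.

Lemma ell2_norm_ge0 x : 0 <= ell2_norm x.
Proof. exact: sqrtr_ge0. Qed.

Lemma ell2_norm_sqr x : ell2_norm x ^+ 2 = \sum_(0 <= k <oo) x k ^+ 2.
Proof. by rewrite sqr_sqrtr ?square_sum_ge0. Qed.

Lemma ell2_partial_le x n : series (fun k => x k ^+ 2) n <= ell2_norm x ^+ 2.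
Proof.
rewrite ell2_norm_sqr; apply: nneg_series_le; last exact: ell2_cvg.
by move=> k; exact: sqr_ge0.
Qed.

Lemma ell2_norm_le x (M : R) : 0 <= M ->
  (forall n, series (fun k => x k ^+ 2) n <= M ^+ 2) -> ell2_norm x <= M.
Proof.
move=> M0 h; rewrite -(ler_sqr _ _) ?nnegrE ?ell2_norm_ge0//.
rewrite ell2_norm_sqr; apply: limr_le; first exact: ell2_cvg.
by apply: nearW => n; exact: h.
Qed.

Lemma ell2_norm_eq0 x : ell2_norm x = 0 -> x = 0.
Proof.
move=> x0; apply/val_inj/funext => k /=.
have := ell2_partial_le x k.+1; rewrite x0 expr0n/= /series/= big_nat_recr//=.
have := sqr_ge0 (x k).
have : 0 <= \sum_(0 <= i < k) x i ^+ 2 by apply: sumr_ge0 => i _; exact: sqr_ge0.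
move=> s0 xk0 le0; apply/eqP; rewrite -sqrf_eq0; apply/eqP; lra.
Qed.

Lemma ell2_normD x z : ell2_norm (x + z) <= ell2_norm x + ell2_norm z.
Proof.
have [x0|x0] := eqVneq (ell2_norm x) 0.
  by rewrite (ell2_norm_eq0 x0) add0r lerDr ell2_norm_ge0.
have [z0|z0] := eqVneq (ell2_norm z) 0.
  by rewrite (ell2_norm_eq0 z0) addr0 lerDl ell2_norm_ge0.
set a := ell2_norm x in x0 *; set b := ell2_norm z in z0 *.
have a0 : 0 < a by rewrite lt_neqAle eq_sym x0 ell2_norm_ge0.
have b0 : 0 < b by rewrite lt_neqAle eq_sym z0 ell2_norm_ge0.
apply: ell2_norm_le => [|n]; first by rewrite addr_ge0// ltW.
have cx : 0 <= (a + b) / a by rewrite divr_ge0// ltW// addr_gt0.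
have cz : 0 <= (a + b) / b by rewrite divr_ge0// ltW// addr_gt0.
apply: (@le_trans _ _ ((a + b) / a * series (fun k => x k ^+ 2) n +
                       (a + b) / b * series (fun k => z k ^+ 2) n)).
  rewrite /series/= !mulr_sumr -big_split/=; apply: ler_sum => k _.
  rewrite fctE -subr_ge0.
  have -> : (a + b) / a * x k ^+ 2 + (a + b) / b * z k ^+ 2 -
            (x k + z k) ^+ 2 = (b * x k - a * z k) ^+ 2 / (a * b).
    by field; rewrite x0 z0.
  by rewrite divr_ge0 ?sqr_ge0// mulr_ge0// ltW.
apply: (@le_trans _ _ ((a + b) / a * a ^+ 2 + (a + b) / b * b ^+ 2)).
  by apply: lerD; apply: ler_wpM2l => //; exact: ell2_partial_le.
by rewrite le_eqVlt; apply/orP; left; apply/eqP; field; rewrite x0 z0.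
Qed.

Lemma ell2_normZ (l : R) x : ell2_norm (l *: x) = `|l| * ell2_norm x.
Proof.
rewrite /ell2_norm.
have -> : \sum_(0 <= k <oo) (l *: x) k ^+ 2 =
          l ^+ 2 * \sum_(0 <= k <oo) x k ^+ 2.
  apply: etrans (limZl_tmp (l ^+ 2) (@ell2_cvg x)); congr (limn _).
  apply/funext => n; rewrite fctE /GRing.scale/= /series/= mulr_sumr.
  by apply: eq_bigr => k _; rewrite -exprMn.
by rewrite sqrtrM ?sqr_ge0// sqrtr_sqr.
Qed.

HB.instance Definition _ := Lmodule_isNormed.Build R (ell2 R)
  ell2_normD ell2_normZ ell2_norm_eq0.

Lemma ell2_unit_subproof (k : nat) :
  (fun j => (j == k)%:R) \in square_summable R.
Proof.
apply/ell1_square_summable/(@nneg_series_cvg _ _ 1) => // n.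
rewrite /series/=; elim: n => [|n IH]; first by rewrite big_geq.
rewrite big_nat_recr//=; case: (eqVneq n k) => [->|_]; last first.
  by rewrite normr0 addr0.
rewrite big_nat big1 ?add0r ?normr1// => i /andP[_ ik].
by rewrite (ltn_eqF ik) normr0.
Qed.

End ell2_normed.

Definition ell2_unit (R : realType) (k : nat) : ell2 R :=
  Ell2 (ell2_unit_subproof R k).

Definition ell2_dot (R : realType) (x z : ell2 R) : R :=
  \sum_(0 <= k <oo) x k * z k.

(* A real Hilbert space is a complete normed module Y together with an inner
   product ip inducing its norm. *)
Definition induces_norm (R : realType) (Y : normedModType R)
    (ip : {dot Y for (@idfun R)}) : Prop :=
  forall v : Y, `|v| ^+ 2 = ip v v.

Definition infinite_dimensional (R : realType) (V : lmodType R) : Prop :=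
  forall (n : nat) (b : 'I_n -> V),
    exists v : V, forall c : 'I_n -> R, v <> \sum_(i < n) c i *: b i.

Definition bounded_operator (R : realType) (V W : normedModType R)
    (A : {linear V -> W}) : Prop :=
  exists C : R, forall x : V, `|A x| <= C * `|x|.

Definition is_adjoint (R : realType) (Y : normedModType R)
    (ip : {dot Y for (@idfun R)}) (A : ell2 R -> Y) (As : Y -> ell2 R) : Prop :=
  forall (x : ell2 R) (v : Y), ip (A x) v = ell2_dot x (As v).

(* Functions on (0, oo) extended by the value 0 at 0 are represented by total
   functions on R; their values at negative arguments are irrelevant. *)
Definition index_function (R : realType) (g : R -> R) : Prop :=
  [/\ g 0 = 0,
      forall t, 0 < t -> 0 < g t,
      forall t, 0 < t -> {for t, continuous g},
      forall s t, 0 < s -> s < t -> g s < g t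
    & g t @[t --> 0^'+] --> (0 : R)].

Definition concave_on_pos (R : realType) (g : R -> R) : Prop :=
  forall s t l : R, 0 < s -> 0 < t -> 0 <= l -> l <= 1 ->
    l * g s + (1 - l) * g t <= g (l * s + (1 - l) * t).

Section functionals.
Variables (R : realType) (Y : completeNormedModType R).
Variables (A : {linear ell2 R -> Y}) (As : Y -> ell2 R).
Variable xdag : ell2 R.

Definition distance_function (r : R) : R :=
  inf [set `|xdag - As v| | v in [set v : Y | `|v| <= r]].

Definition Phi (r : R) : R := distance_function r ^+ 2 / r.

(* pinv is the inverse of the bijection Phi of (0, oo) onto itself. *)
Definition psi_hat (t : R) : R :=
  distance_function (pinv [set r : R | 0 < r] Phi t) ^+ 2.

Definition phi (f : nat -> Y) (t : R) : R :=
  inf [set \sum_(n <= k <oo) `|xdag k| + t * \sum_(0 <= k < n) `|f k|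
      | n in [set n | (1 <= n)%N]].

Definition penalty (eta : R) (x : ell2 R) : R :=
  eta * ell1_norm x + 1 / 2 * `|x| ^+ 2.

Definition error (eta : R) (x z : ell2 R) : R :=
  eta * ell1_norm (x - z) + 1 / 4 * `|x - z| ^+ 2.

Definition tikhonov (eta : R) (yd : Y) (beta : R) (x : ell2 R) : R :=
  1 / 2 * `|A x - yd| ^+ 2 + beta * penalty eta x.

(* As ell^1 is contained in ell^2 (ell1_square_summable), the elements of
   ell^1 are the x : ell2 R with ell1 x. *)
Definition is_tikhonov_minimizer (eta : R) (yd : Y) (beta : R) (x : ell2 R) :
    Prop :=
  ell1 x /\
  forall z : ell2 R, ell1 z -> tikhonov eta yd beta x <= tikhonov eta yd beta z.

(* xr yd beta is the regularized solution for data yd and parameter beta. *)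
Section parameter_choice.
Variables (eta : R) (xr : Y -> R -> ell2 R).

Definition TDP (tau1 tau2 delta : R) (yd : Y) (beta : R) : Prop :=
  [/\ 0 < beta, tau1 * delta <= `|A (xr yd beta) - yd|
    & `|A (xr yd beta) - yd| <= tau2 * delta].

Definition SDP (tau q beta0 delta : R) (yd : Y) (beta : R) : Prop :=
  [/\ exists j : nat, beta = q ^+ j * beta0,
      `|A (xr yd beta) - yd| <= tau * delta
    & tau * delta < `|A (xr yd (beta / q)) - yd|].

Definition Theta (delta beta : R) : R := 17 * delta ^+ 2 / (2 * beta).

Definition lepskii_grid (q beta0 : R) : set R :=
  [set beta0 / q ^+ j | j in [set: nat]].

(* The constant C_E of the quasi-triangle inequality for [error]. *)
Definition C_E : R := 2.

Definition lepskii_admissible (q beta0 delta : R) (yd : Y) : set R :=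
  [set beta | lepskii_grid q beta0 beta /\
     forall beta', lepskii_grid q beta0 beta' -> beta0 <= beta' ->
       beta' < beta ->
       error eta (xr yd beta') (xr yd beta) <= 2 * C_E * Theta delta beta'].

(* The starting value beta0 may depend on delta and yd. *)
Definition LEP (q delta : R) (yd : Y) (beta : R) : Prop :=
  exists beta0 : R,
    [/\ 0 < beta0,
        error eta (xr yd beta0) xdag <= Theta delta beta0,
        lepskii_admissible q beta0 delta yd beta
      & forall b, lepskii_admissible q beta0 delta yd b -> b <= beta].

(* err (xr yd beta) = O(rate delta) as delta -> 0, uniformly in the data yd
   with noise level delta and in the parameters beta allowed by the rule. *)
Definition has_rate (y : Y) (rule : R -> Y -> R -> Prop)
    (err : ell2 R -> R) (rate : R -> R) : Prop :=
  exists C : R, \forall delta \near 0^'+, forall (yd : Y) (beta : R),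
    `|y - yd| <= delta -> rule delta yd beta ->
    err (xr yd beta) <= C * rate delta.

End parameter_choice.

End functionals.

(* Main.v *)
(* The l^1 part of the variational inequality splits the sums at n: source
   conditions e_k = A^* f_k bound |(x - x^dag)_k| by |f_k| |A (x - x^dag)| for
   k < n, and the l^1 tail of x^dag accounts for the rest. The l^2 part writes
   <x^dag, x^dag - x> = <x^dag - A^* v, x^dag - x> - <v, A (x - x^dag)> and
   optimizes over |v| <= r; choosing r with Phi r = |A (x - x^dag)| balances the
   two terms. Such an r exists by the intermediate value theorem alone: the
   distance function is Lipschitz, so no injectivity of Phi and no positivity of
   the distance (i.e. no weak compactness) is needed.

   For the rates, the minimizing property gives
   R(x_beta) - R(x^dag) <= (delta^2 - D^2) / (2 beta), where D is the
   discrepancy, and concavity gives g (c delta) <= c g delta for c >= 1. For TDP the first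
   term is nonpositive. For SDP, the variational inequality at beta / q bounds
   delta^2 / beta by a multiple of g delta. For LEP, the error is at most
   Theta beta whenever beta <= delta^2 / g delta, and the stopping rule is
   compared with the last grid point in that range. *)
Require Import Defs.
From mathcomp Require Import all_boot all_order all_algebra.
From mathcomp Require Import sesquilinear.
From mathcomp Require Import all_classical all_reals all_analysis.
From mathcomp Require Import ring lra.

Set Implicit Arguments.
Unset Strict Implicit.
Unset Printing Implicit Defensive.

Import Order.TTheory GRing.Theory Num.Theory.
Import numFieldNormedType.Exports.

Local Open Scope classical_set_scope.
Local Open Scope ring_scope.

(** * Sequence spaces and inner products *)

Section sequence_spaces.
Variable R : realType.
Implicit Types (u v : nat -> R) (x z w : ell2 R).

Lemma ell2_seqB x z k : (x - z) k = x k - z k.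
Proof. by []. Qed.

Lemma ell2_seqD x z k : (x + z) k = x k + z k.
Proof. by []. Qed.

Lemma ell2_seqZ (a : R) x k : (a *: x) k = a * x k.
Proof. by []. Qed.

Lemma ell1_norm_ge0 u : ell1 u -> 0 <= ell1_norm u.
Proof.
move=> cu; apply: limr_ge => //; apply: nearW => n.
by apply: sumr_ge0.
Qed.

Lemma ell1B x z : ell1 x -> ell1 z -> ell1 (x - z).
Proof.
move=> cx cz; apply: (@nneg_series_cvg _ _ (ell1_norm x + ell1_norm z)) => // n.
apply: le_trans (lerD (nneg_series_le n (fun k => normr_ge0 (x k)) cx)
                      (nneg_series_le n (fun k => normr_ge0 (z k)) cz)).
by rewrite /series/= -big_split/=; apply: ler_sum => k _; exact: ler_normB.
Qed.

Lemma ell1_norm_triangle w x z : ell1 x -> ell1 z -> ell1 w ->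
  ell1_norm (x - z) <= ell1_norm (x - w) + ell1_norm (w - z).
Proof.
move=> cx cz cw; apply: limr_le; first exact: (ell1B cx cz).
apply: nearW => n.
apply: le_trans (lerD
  (nneg_series_le n (fun k => normr_ge0 ((x - w) k)) (ell1B cx cw))
  (nneg_series_le n (fun k => normr_ge0 ((w - z) k)) (ell1B cw cz))).
rewrite /series/= -big_split/=; apply: ler_sum => k _.
exact: (ler_distD (w k) (x k) (z k)).
Qed.

Lemma ell1_normBC x z : ell1_norm (x - z) = ell1_norm (z - x).
Proof.
congr (limn _); apply/funext => n; apply: eq_bigr => k _.
by rewrite !ell2_seqB distrC.
Qed.

(** Expanding the square of a partial sum of absolute values yields the partial sum of squares plus
    nonnegative cross terms. *)
Lemma ell2_norm_le_ell1_norm x : ell1 x -> `|x| <= ell1_norm x.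
Proof.
move=> cx; apply: (@ell2_norm_le _ x); first exact: ell1_norm_ge0.
move=> n; have le_s := nneg_series_le _ (fun k => normr_ge0 (x k)) cx.
apply: (@le_trans _ _ (series (fun k => `|x k|) n ^+ 2)); last first.
  rewrite ler_sqr ?nnegrE ?le_s//; first by apply: sumr_ge0.
  exact: ell1_norm_ge0.
elim: n => [|n IH]; first by rewrite /series/= !big_geq// expr0n.
rewrite /series/= in IH *; rewrite !big_nat_recr//=.
set S := \sum_(0 <= k < n) `|x k| in IH *.
have S0 : 0 <= S by apply: sumr_ge0.
have := mulr_ge0 S0 (normr_ge0 (x n)).
by rewrite -(real_normK (num_real (x n))); nra.
Qed.

Lemma ell1_tailE u n : ell1 u ->
  \sum_(n <= k <oo) `|u k| = ell1_norm u - series (fun k => `|u k|) n.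
Proof.
move=> cu; apply/cvg_lim => //.
apply: cvg_trans (cvgB cu (cvg_cst (series (fun k => `|u k|) n))).
apply: near_eq_cvg; near=> m.
by rewrite !fctE sub_series_geq//; near: m; exact: nbhs_infty_ge.
Unshelve. all: by end_near. Qed.

Lemma ell1_tail_ge0 u n : ell1 u -> 0 <= \sum_(n <= k <oo) `|u k|.
Proof.
by move=> cu; rewrite ell1_tailE// subr_ge0 nneg_series_le.
Qed.

Lemma ell1_tail_cvg0 u : ell1 u ->
  \sum_(n <= k <oo) `|u k| @[n --> \oo] --> 0.
Proof.
move=> cu; under eq_fun do rewrite ell1_tailE//.
rewrite -(subrr (ell1_norm u)).
by apply: cvgB; [exact: cvg_cst|exact: cu].
Qed.

Lemma ell2_dot_cvg x z : cvgn (series (fun k => x k * z k)).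
Proof.
have -> : (fun k => x k * z k) = 2^-1 *: ((fun k => (x + z) k ^+ 2) -
    (fun k => x k ^+ 2) - (fun k => z k ^+ 2)).
  by apply/funext => k; rewrite !fctE ell2_seqD /GRing.scale/=; field.
apply: is_cvg_seriesZ; apply: is_cvg_seriesB; last exact: ell2_cvg.
by apply: is_cvg_seriesB; exact: ell2_cvg.
Qed.

Lemma ell2_normr_sqr x : `|x| ^+ 2 = ell2_dot x x.
Proof. exact: (ell2_norm_sqr x). Qed.

Lemma ell2_dotC x z : ell2_dot x z = ell2_dot z x.
Proof.
by congr (limn _); apply/funext => n; apply: eq_bigr => k _; rewrite mulrC.
Qed.

Lemma ell2_dotDr x z w : ell2_dot x (z + w) = ell2_dot x z + ell2_dot x w.
Proof.
rewrite -[RHS]lim_seriesD; [|exact: ell2_dot_cvg..].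
congr (limn _); apply/funext => n; apply: eq_bigr => k _.
by rewrite ell2_seqD mulrDr.
Qed.

Lemma ell2_dotZr a x z : ell2_dot x (a *: z) = a * ell2_dot x z.
Proof.
rewrite -[RHS]lim_seriesZ; last exact: ell2_dot_cvg.
congr (limn _); apply/funext => n; apply: eq_bigr => k _.
by rewrite ell2_seqZ mulrCA.
Qed.

Lemma ell2_dotBr x z w : ell2_dot x (z - w) = ell2_dot x z - ell2_dot x w.
Proof. by rewrite ell2_dotDr -scaleN1r ell2_dotZr mulN1r. Qed.

Lemma ell2_normBsqr x z :
  `|x - z| ^+ 2 = `|x| ^+ 2 - 2 * ell2_dot x z + `|z| ^+ 2.
Proof.
rewrite !ell2_normr_sqr ell2_dotBr ![ell2_dot (x - z) _]ell2_dotC !ell2_dotBr.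
by rewrite (ell2_dotC z x); ring.
Qed.

Lemma ell2_dot_unit x k : ell2_dot x (ell2_unit R k) = x k.
Proof.
apply/cvg_lim => //; apply: cvg_near_cst; near=> n.
have kn : (k < n)%N by near: n; exact: nbhs_infty_gt.
rewrite big_mkord (bigD1 (Ordinal kn))//= eqxx mulr1 big1 ?addr0// => i.
by rewrite -val_eqE/= => /negPf ->; rewrite mulr0.
Unshelve. all: by end_near. Qed.

(** The triangle inequality is already part of the norm structure; squaring it and comparing with
    the expansion of the squared norm of [x - z] leaves this bound. *)
Lemma ell2_CauchySchwarz x z : - ell2_dot x z <= `|x| * `|z|.
Proof.
have := ell2_normBsqr x z; have := ler_normB x z.
have := normr_ge0 (x - z); have := normr_ge0 x; have := normr_ge0 z.
nra.
Qed.

End sequence_spaces.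

Section inner_product.
Variables (R : realType) (Y : normedModType R) (ip : {dot Y for (@idfun R)}).
Hypothesis hip : induces_norm ip.

(** Again read off from the squared triangle inequality, now for [v + w]. *)
Lemma ip_CauchySchwarz (v w : Y) : ip v w <= `|v| * `|w|.
Proof.
have := ler_normD v w; have := normr_ge0 (v + w).
have := normr_ge0 v; have := normr_ge0 w.
have : `|v + w| ^+ 2 = `|v| ^+ 2 + 2 * ip v w + `|w| ^+ 2.
  rewrite !hip linearDl !linearDr/= (hermC _ w v) /= expr0 mul1r; ring.
nra.
Qed.

Lemma ip_CauchySchwarz_norm (v w : Y) : `|ip v w| <= `|v| * `|w|.
Proof.
rewrite ler_norml ip_CauchySchwarz andbT lerNl -linearNr.
by rewrite (le_trans (ip_CauchySchwarz _ _))// normrN.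
Qed.

End inner_product.

(** * Concave index functions and the function phi *)

Section index_functions.
Variable R : realType.
Implicit Types g h : R -> R.

Lemma index_functionD g h (a b : R) : 0 < a -> 0 < b ->
  index_function g -> index_function h ->
  index_function (fun t => a * g t + b * h t).
Proof.
move=> a0 b0 [g0 gp gc gi gl] [h0 hp hc hi hl]; split.
- by rewrite g0 h0 !mulr0 addr0.
- by move=> t t0; rewrite addr_gt0// mulr_gt0// ?gp// hp.
- by move=> t t0; apply: cvgD; apply: cvgM; [exact: cvg_cst|exact: gc|
    exact: cvg_cst|exact: hc].
- by move=> s t s0 st; rewrite ltrD// ltr_pM2l// ?gi// hi.
- suff : a * g t + b * h t @[t --> 0^'+] --> a * 0 + b * 0.
    by rewrite !mulr0 addr0.
  by apply: cvgD; apply: cvgM; [exact: cvg_cst|exact: gl|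
    exact: cvg_cst|exact: hl].
Qed.

Lemma concave_on_posD g h (a b : R) : 0 <= a -> 0 <= b ->
  concave_on_pos g -> concave_on_pos h ->
  concave_on_pos (fun t => a * g t + b * h t).
Proof.
move=> a0 b0 cg ch s t l s0 t0 l0 l1.
have := ler_wpM2l a0 (cg s t l s0 t0 l0 l1).
have := ler_wpM2l b0 (ch s t l s0 t0 l0 l1).
set u := l * s + _; lra.
Qed.

Lemma index_function_id g : (forall t, 0 <= t -> g t = t) -> index_function g.
Proof.
move=> gE; split.
- exact: gE.
- by move=> t t0; rewrite gE// ltW.
- move=> t t0; change (g @ t --> g t); rewrite (gE t) ?ltW//.
  apply: (@cvg_trans _ (id @ t)); last exact: cvg_id.
  apply: near_eq_cvg; near=> s.
  by rewrite gE// ltW//; near: s; exact: lt_nbhsr.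
- by move=> s t s0 st; rewrite !gE// ltW// (lt_trans s0).
- apply: (@cvg_trans _ (id @ 0^'+)); last exact: cvg_at_right_filter.
  apply: near_eq_cvg; near=> s.
  by rewrite gE// ltW//; near: s; exact: nbhs_right_gt.
Unshelve. all: by end_near. Qed.

Lemma concave_on_pos_id g : (forall t, 0 <= t -> g t = t) -> concave_on_pos g.
Proof.
move=> gE s t l s0 t0 l0 l1; rewrite (gE s (ltW s0)) (gE t (ltW t0)) gE//.
by rewrite addr_ge0// mulr_ge0// ?subr_ge0// ltW.
Qed.

Lemma index_function_ge0 g t : index_function g -> 0 <= t -> 0 <= g t.
Proof.
move=> [g0 gp _ _ _]; rewrite le_eqVlt => /predU1P[<-|/gp/ltW//].
by rewrite g0.
Qed.

(* If [g s > c * g t], write [t] as a convex combination of [s] and some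
   [r > 0] with weight [g t / g s] on [s]: concavity then forces [g r <= 0]. *)
Lemma concave_index_le g (c s t : R) : index_function g -> concave_on_pos g ->
  1 <= c -> 0 < t -> 0 <= s -> s <= c * t -> g s <= c * g t.
Proof.
move=> ig cg c1 t0 s0 sct; have [g0 gp _ gi _] := ig.
have gt0 := gp _ t0.
have [st|ts] := leP s t.
  apply: (@le_trans _ _ (g t)); last by nra.
  move: s0; rewrite le_eqVlt => /predU1P[<-|s0]; first by rewrite g0 ltW.
  by move: st; rewrite le_eqVlt => /predU1P[<-//|st]; rewrite ltW// gi.
have {}s0 : 0 < s by rewrite (lt_trans t0).
rewrite leNgt; apply/negP => cgts.
have gs0 := gp _ s0.
pose l := g t / g s.
have lE : l * g s = g t by rewrite /l divfK// gt_eqF.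
have l0 : 0 < l by rewrite divr_gt0.
have l1 : l < 1 by rewrite /l ltr_pdivrMr// mul1r gi.
have ls_t : l * s < t.
  have : l * c < 1 by rewrite /l mulrAC ltr_pdivrMr// mul1r mulrC.
  nra.
pose r := (t - l * s) / (1 - l).
have r0 : 0 < r by rewrite divr_gt0// subr_gt0.
have := cg s r l s0 r0 (ltW l0) (ltW l1).
have -> : l * s + (1 - l) * r = t.
  by rewrite /r; field; rewrite subr_eq0 gt_eqF.
rewrite lE gerDl; apply/negP; rewrite -ltNge mulr_gt0 ?subr_gt0//.
exact: gp.
Qed.

End index_functions.

Section phi_theory.
Variables (R : realType) (Y : completeNormedModType R).
Variables (xdag : ell2 R) (f : nat -> Y).
Hypothesis xdag_ell1 : ell1 xdag.

Let tail n := \sum_(n <= k <oo) `|xdag k|.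
Let slope n := \sum_(0 <= k < n) `|f k|.

Lemma phi_le t n : 0 <= t -> (1 <= n)%N ->
  phi xdag f t <= \sum_(n <= k <oo) `|xdag k| + t * \sum_(0 <= k < n) `|f k|.
Proof.
move=> t0 n1; apply: ge_inf; last by exists n.
exists 0 => _ [m _ <-].
by rewrite addr_ge0 ?ell1_tail_ge0// mulr_ge0// sumr_ge0.
Qed.

Lemma phi_ge t M :
  (forall n, (1 <= n)%N ->
     M <= \sum_(n <= k <oo) `|xdag k| + t * \sum_(0 <= k < n) `|f k|) ->
  M <= phi xdag f t.
Proof.
move=> hM; apply: lb_le_inf; first by exists (tail 1 + t * slope 1), 1.
by move=> _ [n n1 <-]; exact: hM.
Qed.

Lemma phi_ge0 t : 0 <= t -> 0 <= phi xdag f t.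
Proof.
move=> t0; apply: phi_ge => n _.
by rewrite addr_ge0 ?ell1_tail_ge0// mulr_ge0// sumr_ge0.
Qed.

(** The infimum runs over affine functions of [t], so it suffices to compare with one competitor [n]
    at a time. *)
Lemma phi_concave : concave_on_pos (phi xdag f).
Proof.
move=> s t l s0 t0 l0 l1; apply: phi_ge => n n1.
have := ler_wpM2l l0 (phi_le (ltW s0) n1).
have l1' : 0 <= 1 - l by rewrite subr_ge0.
have := ler_wpM2l l1' (phi_le (ltW t0) n1).
rewrite -/(tail n) -/(slope n); lra.
Qed.

(** First fix [n] with tail below [e / 2], then take [t] so small that the term [t * slope n] is
    below [e / 2] as well. *)
Lemma phi_cvg0 : phi xdag f t @[t --> 0^'+] --> 0.
Proof.
apply/cvgrPdist_lt => e e0.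
have /cvgrPdist_lt/(_ _ (divr_gt0 e0 (ltr0Sn R 1)))[N _ hN] :=
  ell1_tail_cvg0 xdag_ell1.
pose n := N.+1; have := hN n (leqnSn N).
rewrite sub0r normrN ger0_norm ?ell1_tail_ge0// -/(tail n) => tn.
have sn0 : 0 <= slope n by exact: sumr_ge0.
near=> t.
have t0 : 0 < t by near: t; exact: nbhs_right_gt.
rewrite sub0r normrN ger0_norm ?phi_ge0 ?(ltW t0)//.
apply: le_lt_trans (phi_le (ltW t0) (isT : (1 <= n)%N)) _.
rewrite -/(tail n) -/(slope n).
have : t < e / 2 / (slope n + 1).
  by near: t; apply: nbhs_right_lt; rewrite divr_gt0// ?divr_gt0//; lra.
rewrite ltr_pdivlMr; last lra.
nra.
Unshelve. all: by end_near. Qed.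

Hypothesis f_neq0 : f 0 != 0.

Lemma phi_index : index_function (phi xdag f).
Proof.
have f0 : 0 < `|f 0%N| by rewrite normr_gt0.
have slope_ge n : (1 <= n)%N -> `|f 0%N| <= slope n.
  by case: n => // n _; rewrite /slope big_nat_recl// lerDl sumr_ge0.
(* Every competitor has slope at least [|f 0|], which is positive; this makes the infimum strictly
   increasing. *)
have phi_lt s t : 0 <= s -> s < t -> phi xdag f s < phi xdag f t.
  move=> s0 st; apply: (@lt_le_trans _ _ (phi xdag f s + (t - s) * `|f 0%N|)).
    by rewrite ltrDl mulr_gt0// subr_gt0.
  apply: phi_ge => n n1; have := phi_le s0 n1; have := slope_ge n n1.
  rewrite -/(tail n) -/(slope n); nra.
(* The quotient of [phi] by its argument is nonincreasing because the tails are nonnegative. *)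
have phi_scale s t : 0 < s -> s <= t -> phi xdag f t * s <= phi xdag f s * t.
  move=> s0 st; have t0 : 0 < t by exact: lt_le_trans st.
  rewrite -ler_pdivrMr//; apply: phi_ge => n n1; rewrite ler_pdivrMr//.
  have := phi_le (ltW t0) n1; have := ell1_tail_ge0 n xdag_ell1.
  rewrite -/(tail n) -/(slope n) => tn0 le_t.
  apply: le_trans (ler_wpM2r (ltW s0) le_t) _; nra.
(* At 0 only the tails remain, and they tend to 0. *)
have phi00 : phi xdag f 0 = 0.
  apply/eqP; rewrite eq_le phi_ge0// andbT.
  rewrite -[leRHS](cvg_lim _ (ell1_tail_cvg0 xdag_ell1))//.
  apply: limr_ge; first by apply/cvg_ex; exists 0; exact: ell1_tail_cvg0.
  near=> n; have n1 : (1 <= n)%N by near: n; exact: nbhs_infty_ge.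
  by rewrite (le_trans (phi_le (lexx 0) n1))// mul0r addr0.
split=> //.
- by move=> t t0; rewrite -phi00 phi_lt.
- move=> t t0; apply/cvgrPdist_le => e e0.
  have pt0 : 0 < phi xdag f t by rewrite -phi00 phi_lt.
  near=> s.
  have s0 : 0 < s by near: s; exact: lt_nbhsr.
  (* Continuity at [t]: applied on either side of [t], [phi_scale] gives the Lipschitz bound with
     constant [phi xdag f t / t]. *)
  apply: (@le_trans _ _ (phi xdag f t / t * `|t - s|)).
    rewrite -mulrAC ler_pdivlMr//.
    have [st|ts] := leP s t.
      rewrite (ger0_norm (_ : 0 <= t - s)) ?subr_ge0// ger0_norm; last first.
        rewrite subr_ge0; move: st; rewrite le_eqVlt => /predU1P[->//|st].
        by rewrite ltW// phi_lt// ltW.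
      have := phi_scale s t s0 st; lra.
    rewrite (ltr0_norm (_ : t - s < 0)) ?subr_lt0// ltr0_norm; last first.
      by rewrite subr_lt0 phi_lt// ltW.
    have := phi_scale t s t0 (ltW ts); lra.
  rewrite mulrC -ler_pdivlMr ?divr_gt0//.
  near: s; apply: cvgr_dist_le; first exact: cvg_id.
  by rewrite divr_gt0// divr_gt0.
- by move=> s t s0 st; rewrite phi_lt// ltW.
- exact: phi_cvg0.
Unshelve. all: by end_near. Qed.

End phi_theory.

(** * The distance function and the variational inequality *)

Section adjoint.
Variables (R : realType) (Y : completeNormedModType R).
Variables (ip : {dot Y for (@idfun R)}) (hip : induces_norm ip).
Variables (A : {linear ell2 R -> Y}) (As : Y -> ell2 R).
Hypothesis A_adjoint : is_adjoint ip A As.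
Variable xdag : ell2 R.

Lemma adjoint_seqE v k : As v k = ip (A (ell2_unit R k)) v.
Proof. by rewrite A_adjoint ell2_dotC ell2_dot_unit. Qed.

(** [As] is merely a map satisfying the adjoint identity; additivity is inherited coordinatewise
    from the inner product through [adjoint_seqE]. *)
Lemma adjointB v w : As (v - w) = As v - As w.
Proof.
apply/val_inj/funext => k; change (As (v - w) k = As v k - As w k).
by rewrite !adjoint_seqE linearBr.
Qed.

Lemma adjoint0 : As 0 = 0.
Proof. by rewrite -[X in As X](subrr 0) adjointB subrr. Qed.

(** The squared norm of [As v] equals [ip (A (As v)) v]; Cauchy-Schwarz bounds it, and one factor
    [|As v|] cancels. *)
Lemma adjoint_bounded : bounded_operator A ->
  exists2 C : R, 0 < C & forall v, `|As v| <= C * `|v|.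
Proof.
move=> [C hC]; exists (`|C| + 1) => [|v]; first by rewrite ltr_wpDl.
have [->|Asv0] := eqVneq (As v) 0.
  by rewrite normr0 mulr_ge0// addr_ge0.
have Asv_gt0 : 0 < `|As v| by rewrite normr_gt0.
rewrite -(ler_pM2l Asv_gt0) -expr2 ell2_normr_sqr -A_adjoint.
apply: le_trans (ip_CauchySchwarz hip _ _) _; rewrite mulrA.
apply: ler_wpM2r => //; apply: le_trans (hC _) _.
rewrite mulrC; apply: ler_wpM2l => //.
by rewrite (le_trans (ler_norm _))// lerDl.
Qed.

(** The coordinate [x k] is the product of [x] with [As (f k)], hence equals [ip (A x) (f k)]. *)
Lemma source_seq_le (f : nat -> Y) (x : ell2 R) k :
  As (f k) = ell2_unit R k -> `|x k| <= `|f k| * `|A x|.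
Proof.
move=> fk; rewrite -(ell2_dot_unit x k) -fk -A_adjoint mulrC.
exact: ip_CauchySchwarz_norm.
Qed.

Lemma source_neq0 (f : nat -> Y) k : As (f k) = ell2_unit R k -> f k != 0.
Proof.
move=> fk; apply/eqP => fk0; have : ell2_unit R k k = (0 : ell2 R) k.
  by rewrite -fk fk0 adjoint0.
by rewrite /= eqxx => /eqP; rewrite oner_eq0.
Qed.

Lemma distance_function_le r v : `|v| <= r ->
  distance_function As xdag r <= `|xdag - As v|.
Proof.
move=> vr; apply: ge_inf; last by exists v.
by exists 0 => _ [w _ <-].
Qed.

Lemma distance_function_ge r M : 0 <= r ->
  (forall v, `|v| <= r -> M <= `|xdag - As v|) ->
  M <= distance_function As xdag r.
Proof.
move=> r0 hM; apply: lb_le_inf.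
  by exists `|xdag - As 0|, 0; rewrite //= normr0.
by move=> _ [v vr <-]; exact: hM.
Qed.

Lemma distance_function_ge0 r : 0 <= r -> 0 <= distance_function As xdag r.
Proof. by move=> r0; exact: distance_function_ge. Qed.

Lemma distance_function_norm r : 0 <= r ->
  distance_function As xdag r <= `|xdag|.
Proof.
move=> r0; rewrite -[xdag in leRHS]subr0 -adjoint0.
by apply: distance_function_le; rewrite normr0.
Qed.

Lemma distance_function0 : distance_function As xdag 0 = `|xdag|.
Proof.
apply/eqP; rewrite eq_le distance_function_norm//=.
apply: distance_function_ge => // v; rewrite normr_le0 => /eqP ->.
by rewrite adjoint0 subr0.
Qed.

(* Shrinking [v] to [(s / r) *: v] moves it by at most [r - s]. *)
Lemma distance_function_lip (C s r : R) : 0 <= C ->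
  (forall v, `|As v| <= C * `|v|) -> 0 <= s -> s <= r ->
  `|distance_function As xdag s - distance_function As xdag r| <= C * (r - s).
Proof.
move=> C0 hC s0 sr; have r0 := le_trans s0 sr.
have drs : distance_function As xdag r <= distance_function As xdag s.
  apply: distance_function_ge => // v vs; apply: distance_function_le.
  exact: le_trans sr.
rewrite ger0_norm ?subr_ge0// lerBlDl -lerBlDr.
apply: distance_function_ge => // v vr.
have [r00|r_neq0] := eqVneq r 0.
  have -> : s = r by apply/eqP; rewrite eq_le sr r00.
  by rewrite subrr mulr0 subr0; exact: distance_function_le.
have r_gt0 : 0 < r by rewrite lt_neqAle eq_sym r_neq0.
have sr0 : 0 <= s / r by rewrite divr_ge0.
pose w := (s / r) *: v.
have ws : `|w| <= s.
  rewrite normrZ ger0_norm//; apply: le_trans (ler_wpM2l sr0 vr) _.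
  by rewrite divfK.
have vw : `|v - w| <= r - s.
  have -> : v - w = (1 - s / r) *: v by rewrite scalerBl scale1r.
  have sr1 : 0 <= 1 - s / r by rewrite subr_ge0 ler_pdivrMr// mul1r.
  rewrite normrZ ger0_norm//; apply: le_trans (ler_wpM2l sr1 vr) _.
  by rewrite mulrBl mul1r divfK.
rewrite lerBlDr; apply: le_trans (distance_function_le ws) _.
have -> : xdag - As w = (xdag - As v) + As (v - w).
  by rewrite adjointB addrA subrK.
apply: le_trans (ler_normD _ _) _; rewrite lerD2l.
by apply: le_trans (hC _) _; exact: ler_wpM2l.
Qed.

Lemma Phi_surj t : bounded_operator A -> xdag != 0 -> 0 < t ->
  exists2 r, 0 < r & Phi As xdag r = t.
Proof.
move=> Abd xdag0 t0; have [C C0 hC] := adjoint_bounded Abd.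
have N0 : 0 < `|xdag| by rewrite normr_gt0.
(* The absolute value extends the distance function to a continuous function on all of R. *)
pose d (r : R) := distance_function As xdag `|r|.
pose h (r : R) := d r ^+ 2 - t * r.
have d_cont : continuous d.
  move=> r; apply/cvgrPdist_le => e e0.
  have d_lip : forall s, `|d r - d s| <= C * `|r - s|.
    move=> s; apply: (@le_trans _ _ (C * `| `|r| - `|s| |)); last first.
      by rewrite ler_wpM2l// ?(ltW C0)// ler_dist_dist.
    have [rs|sr] := leP `|r| `|s|.
      rewrite (ler0_norm (_ : `|r| - `|s| <= 0)) ?subr_le0// opprB.
      exact: distance_function_lip (ltW C0) hC (normr_ge0 r) rs.
    rewrite (gtr0_norm (_ : 0 < `|r| - `|s|)) ?subr_gt0// distrC.
    exact: distance_function_lip (ltW C0) hC (normr_ge0 s) (ltW sr).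
  near=> s; apply: le_trans (d_lip s) _; rewrite mulrC -ler_pdivlMr//.
  by near: s; apply: cvgr_dist_le; [exact: cvg_id|rewrite divr_gt0].
have h_cont : continuous h.
  move=> r; apply: cvgB; last by apply: cvgM; [exact: cvg_cst|exact: cvg_id].
  by rewrite expr2; apply: cvgM; exact: d_cont.
(* At this endpoint [t * b] equals the squared norm of [xdag], which dominates the squared distance,
   so [h] changes sign on [0, b]. *)
pose b := `|xdag| ^+ 2 / t.
have b0 : 0 < b by rewrite divr_gt0// exprn_gt0.
have h0 : 0 < h 0.
  by rewrite /h /d normr0 distance_function0 mulr0 subr0 exprn_gt0.
have hb : h b <= 0.
  have tb : t * b = `|xdag| ^+ 2 by rewrite /b mulrC divfK// gt_eqF.
  rewrite /h tb subr_le0 ler_sqr ?nnegrE//; last first.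
    exact: distance_function_ge0.
  exact: distance_function_norm.
have [||c] := @IVT R h 0 b 0 (ltW b0).
- exact: continuous_subspaceT.
- by rewrite ge_min hb orbT/= le_max (ltW h0).
rewrite in_itv/= => /andP[]; rewrite le_eqVlt => /predU1P[<-|c0] _ hc.
  by rewrite hc ltxx in h0.
exists c => //; rewrite /Phi; move/eqP: hc.
rewrite /h /d gtr0_norm// subr_eq0 => /eqP ->.
by rewrite mulfK// gt_eqF.
Unshelve. all: by end_near. Qed.

(** [pinv] picks a preimage of [t] under [Phi], at which the squared distance and [r * t] coincide;
    this is the radius that balances the two terms of [error2_le]. *)
Lemma psi_hatP t : bounded_operator A -> xdag != 0 -> 0 < t ->
  exists r, [/\ 0 <= r, distance_function As xdag r ^+ 2 = r * t
    & psi_hat As xdag t = r * t].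
Proof.
move=> Abd xdag0 t0; have [r r0 rt] := Phi_surj Abd xdag0 t0.
pose P := [set r : R | 0 < r].
have Pt : (Phi As xdag @` P) t by exists r.
pose r' := pinv P (Phi As xdag) t.
have r'0 : 0 < r'.
  by apply: (surjpinv_image_sub (@subset_refl _ (Phi As xdag @` P))); exists t.
have : Phi As xdag r' = t by rewrite /r' pinvK ?inE.
rewrite /Phi => /(canRL (divfK (negbT (gt_eqF r'0)))) dr'.
by exists r'; split; [exact: ltW|rewrite dr' mulrC|rewrite /psi_hat dr' mulrC].
Qed.

(** With [a = |xdag - As v|], Young's inequality [|h| * a <= |h|^2 / 4 + a^2] spends half of the
    [|h|^2 / 2] obtained by expanding [|x|^2]; the rest is the left-hand side. *)
Lemma error2_le (x : ell2 R) r : 0 <= r ->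
  1 / 4 * `|x - xdag| ^+ 2 <= 1 / 2 * `|x| ^+ 2 - 1 / 2 * `|xdag| ^+ 2 +
    (distance_function As xdag r ^+ 2 + r * `|A (x - xdag)|).
Proof.
move=> r0; set h := x - xdag; set M := 1 / 4 * _.
suff : M - 1 / 2 * `|x| ^+ 2 + 1 / 2 * `|xdag| ^+ 2 - r * `|A h| <=
    distance_function As xdag r ^+ 2 by lra.
(* The distance is an infimum of norms, not of squares, so [M'] is compared with it through its
   square root; since the root of a negative number is 0, the case [M' <= 0] is settled
   separately. *)
set M' := _ - r * _.
have dM : Num.sqrt M' <= distance_function As xdag r.
  apply: distance_function_ge => // v vr.
  rewrite -[leRHS]ger0_norm// -sqrtr_sqr; apply: ler_wsqrtr.
  have := ell2_CauchySchwarz h (xdag - As v).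
  rewrite ell2_dotBr -A_adjoint.
  have := ip_CauchySchwarz hip (- A h) v; rewrite linearNl normrN.
  have := ler_wpM2l (normr_ge0 (A h)) vr.
  have := sqr_ge0 (`|h| - 2 * `|xdag - As v|).
  have xE : `|x| ^+ 2 = `|h| ^+ 2 + 2 * ell2_dot h xdag + `|xdag| ^+ 2.
    have := ell2_normBsqr x xdag.
    have -> : ell2_dot h xdag = ell2_dot x xdag - `|xdag| ^+ 2.
      by rewrite ell2_dotC ell2_dotBr ell2_dotC ell2_normr_sqr.
    by rewrite -/h; lra.
  rewrite /M' /M xE sqrrB exprMn; lra.
have [M'0|M'0] := leP M' 0; first by rewrite (le_trans M'0)// sqr_ge0.
rewrite -(sqr_sqrtr (ltW M'0)) ler_sqr ?nnegrE ?sqrtr_ge0//.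
exact: distance_function_ge0.
Qed.

Lemma error1_le (f : nat -> Y) (x : ell2 R) :
  (forall k, As (f k) = ell2_unit R k) -> ell1 xdag -> ell1 x ->
  ell1_norm (x - xdag) <=
    ell1_norm x - ell1_norm xdag + 2 * phi xdag f `|A (x - xdag)|.
Proof.
move=> hf cdag cx; set t := `|A (x - xdag)|.
suff : (ell1_norm (x - xdag) - ell1_norm x + ell1_norm xdag) / 2 <=
    phi xdag f t by lra.
apply: phi_ge => // n n1; rewrite ell1_tailE//.
suff : ell1_norm (x - xdag) <= ell1_norm x + ell1_norm xdag +
    2 * (t * \sum_(0 <= k < n) `|f k|) - 2 * series (fun k => `|xdag k|) n.
  lra.
apply: limr_le; first exact: (ell1B cx cdag).
near=> m; have nm : (n <= m)%N by near: m; exact: nbhs_infty_ge.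
have := nneg_series_le m (fun k => normr_ge0 (x k)) cx.
have := nneg_series_le m (fun k => normr_ge0 (xdag k)) cdag.
rewrite -/(ell1_norm x) -/(ell1_norm xdag) /series/=.
rewrite !(big_cat_nat (n := n) (leq0n n) nm)/=.
have : \sum_(n <= k < m) `|(x - xdag) k| <=
    \sum_(n <= k < m) `|x k| + \sum_(n <= k < m) `|xdag k|.
  by rewrite -big_split/=; apply: ler_sum => k _; exact: ler_normB.
have : \sum_(0 <= k < n) `|(x - xdag) k| <= t * \sum_(0 <= k < n) `|f k|.
  rewrite mulr_sumr; apply: ler_sum => k _; rewrite mulrC.
  exact: source_seq_le.
(* The first [n] entries of [x - xdag] thus enter twice, directly and through this bound, whence the
   factor 2 in front of [phi]. *)
have : \sum_(0 <= k < n) `|xdag k| <= \sum_(0 <= k < n) `|(x - xdag) k| +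
    \sum_(0 <= k < n) `|x k|.
  rewrite -big_split/=; apply: ler_sum => k _.
  rewrite -lerBlDr; apply: le_trans (lerB_dist _ _) _.
  by rewrite distrC.
rewrite /series/=; lra.
Unshelve. all: by end_near. Qed.
End adjoint.

(** * Parameter choice rules *)

Section error_functional.
Variables (R : realType) (eta : R) (eta_ge0 : 0 <= eta).
Implicit Types x z w : ell2 R.

Lemma errorC x z : error eta x z = error eta z x.
Proof. by rewrite /error ell1_normBC distrC. Qed.

Lemma error_ge0 x z : ell1 x -> ell1 z -> 0 <= error eta x z.
Proof.
move=> cx cz; have := ell1_norm_ge0 (ell1B cx cz).
by move=> ?; rewrite /error addr_ge0 ?mulr_ge0// sqr_ge0.
Qed.

(** The l^1 part obeys the triangle inequality; the factor 2, which is [C_E], comes from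
    [(b + c)^2 <= 2 * (b^2 + c^2)] in the l^2 part. *)
Lemma error_quasi_triangle w x z : ell1 x -> ell1 z -> ell1 w ->
  error eta x z <= 2 * (error eta x w + error eta w z).
Proof.
move=> cx cz cw; rewrite /error.
have := ler_wpM2l eta_ge0 (ell1_norm_triangle cx cz cw).
have := mulr_ge0 eta_ge0 (ell1_norm_ge0 (ell1B cx cw)).
have := mulr_ge0 eta_ge0 (ell1_norm_ge0 (ell1B cw cz)).
have := ler_distD w x z; have := normr_ge0 (x - z).
have := normr_ge0 (x - w); have := normr_ge0 (w - z).
have := sqr_ge0 (`|x - w| - `|w - z|).
rewrite mulrDr.
set a := `|x - z|; set b := `|x - w|; set c := `|w - z|.
move=> h1 b0 c0 a0 abc h2 h3 h4.
have : a ^+ 2 <= (b + c) ^+ 2 by rewrite ler_sqr ?nnegrE ?addr_ge0.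
lra.
Qed.

Lemma ell1_norm_le_error x z : eta * ell1_norm (x - z) <= error eta x z.
Proof. by rewrite lerDl mulr_ge0// sqr_ge0. Qed.

End error_functional.

(** * Error bounds at a fixed noise level, for any concave index function in the variational
    inequality *)

Section convergence_rates.
Variables (R : realType) (Y : completeNormedModType R).
Variables (A : {linear ell2 R -> Y}) (eta : R) (xdag : ell2 R) (g : R -> R).
Hypotheses (eta_ge0 : 0 <= eta) (xdag_ell1 : ell1 xdag).
Hypotheses (g_index : index_function g) (g_concave : concave_on_pos g).
Hypothesis variational_inequality : forall x : ell2 R, ell1 x ->
  error eta x xdag <=
    penalty eta x - penalty eta xdag + g `|A (x - xdag)|.
Variables (delta : R) (yd : Y).
Hypotheses (delta_gt0 : 0 < delta) (yd_delta : `|A xdag - yd| <= delta).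

Let gd_gt0 : 0 < g delta.
Proof. by case: g_index => _ + _ _ _; apply. Qed.

Section minimizer.
Variables (x : ell2 R) (beta : R).
Hypothesis beta_gt0 : 0 < beta.
Hypothesis x_min : is_tikhonov_minimizer A eta yd beta x.

Lemma minimizer_penalty_le :
  penalty eta x - penalty eta xdag <=
    (delta ^+ 2 - `|A x - yd| ^+ 2) / (2 * beta).
Proof.
rewrite ler_pdivlMr ?mulr_gt0//.
have := x_min.2 _ xdag_ell1; rewrite /tikhonov.
have : `|A xdag - yd| ^+ 2 <= delta ^+ 2 by rewrite ler_sqr ?nnegrE// ltW.
lra.
Qed.

Lemma residual_le : `|A (x - xdag)| <= `|A x - yd| + delta.
Proof.
rewrite linearB; apply: le_trans (ler_distD yd _ _) _.
by rewrite lerD2l distrC.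
Qed.

Lemma g_residual_le c : 1 <= c -> `|A x - yd| + delta <= c * delta ->
  g `|A (x - xdag)| <= c * g delta.
Proof.
move=> c1 cd; apply: concave_index_le => //.
exact: le_trans residual_le cd.
Qed.

Lemma error_le_residual :
  error eta x xdag <= (delta ^+ 2 - `|A x - yd| ^+ 2) / (2 * beta) +
    (`|A x - yd| / delta + 1) * g delta.
Proof.
apply: le_trans (variational_inequality x_min.1) _.
apply: lerD; first exact: minimizer_penalty_le.
(* The factor [c = D / delta + 1], with [D] the discrepancy, is the one for which
   [c * delta = D + delta]. *)
apply: g_residual_le; first by rewrite lerDr divr_ge0// ltW.
by rewrite mulrDl mul1r divfK ?gt_eqF.
Qed.

(* By Young's inequality
   [D * g delta / delta <= D^2 / (2 beta) + beta (g delta)^2 / (2 delta^2)]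
   for the discrepancy [D], so the discrepancies cancel. *)
Lemma error_le_small_parameter :
  beta * g delta <= delta ^+ 2 -> error eta x xdag <= Theta delta beta.
Proof.
move=> bgd; apply: le_trans error_le_residual _; rewrite /Theta.
set D := `|A x - yd|; set G := g delta in bgd *.
have G0 : 0 < G := gd_gt0.
(* It remains to bound [2 * D * s + 2 * beta * G] by [16 * delta^2 + D^2], where
   [s = beta * G / delta] is at most [delta]. *)
have -> : 17 * delta ^+ 2 / (2 * beta) =
    (delta ^+ 2 - D ^+ 2) / (2 * beta) +
    (16 * delta ^+ 2 + D ^+ 2) / (2 * beta).
  by field; rewrite gt_eqF.
rewrite lerD2l ler_pdivlMr ?mulr_gt0//.
have -> : (D / delta + 1) * G * (2 * beta) =
    2 * D * (beta * G / delta) + 2 * (beta * G).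
  by field; rewrite gt_eqF.
have bG : beta * G / delta <= delta by rewrite ler_pdivrMr// -expr2.
have bG0 : 0 <= beta * G / delta by rewrite divr_ge0 ?mulr_ge0// ltW.
have D0 : 0 <= D by exact: normr_ge0.
set s := beta * G / delta in bG bG0 *.
have := sqr_ge0 (D - s); have : s ^+ 2 <= delta ^+ 2.
  by rewrite ler_sqr ?nnegrE// ltW.
have := sqr_ge0 delta; nra.
Qed.

End minimizer.

Variable xr : Y -> R -> ell2 R.
Hypothesis xr_min : forall beta, 0 < beta ->
  is_tikhonov_minimizer A eta yd beta (xr yd beta).

Lemma TDP_error_le tau1 tau2 beta : 1 <= tau1 ->
  TDP A xr tau1 tau2 delta yd beta ->
  error eta (xr yd beta) xdag <= (tau2 + 1) * g delta.
Proof.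
move=> tau1_ge1 [b0 lo up]; have xm := xr_min b0.
apply: le_trans (variational_inequality xm.1) _.
have pen0 : penalty eta (xr yd beta) - penalty eta xdag <= 0.
  apply: le_trans (minimizer_penalty_le b0 xm) _.
  rewrite mulr_le0_ge0 ?invr_ge0 ?mulr_ge0 ?(ltW b0)// subr_le0.
  rewrite ler_sqr ?nnegrE ?(ltW delta_gt0)//; apply: le_trans lo.
  by rewrite ler_peMl// ltW.
rewrite -[leRHS]add0r; apply: lerD => //.
have tau2_ge0 : 0 <= tau2.
  by rewrite -(pmulr_lge0 _ delta_gt0) (le_trans _ up).
apply: g_residual_le => //; first by rewrite lerDr.
by rewrite mulrDl mul1r lerD2r.
Qed.

Lemma SDP_error_le tau q beta0 beta : 1 < tau -> 0 < q -> 0 < beta0 ->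
  SDP A xr tau q beta0 delta yd beta ->
  error eta (xr yd beta) xdag <= ((q * (tau - 1))^-1 + (tau + 1)) * g delta.
Proof.
move=> tau1 q0 b00 [[j betaE] up lo].
have b0 : 0 < beta by rewrite betaE mulr_gt0// exprn_gt0.
move: beta b0 up lo {betaE} => b b0 up lo.
have bq0 : 0 < b / q by rewrite divr_gt0.
apply: le_trans (variational_inequality (xr_min b0).1) _.
rewrite mulrDl; apply: lerD; last first.
  apply: g_residual_le => //; first by rewrite lerDr ltW// (lt_trans ltr01).
  by rewrite mulrDl mul1r lerD2r.
apply: le_trans (minimizer_penalty_le b0 (xr_min b0)) _.
apply: (@le_trans _ _ (delta ^+ 2 / (2 * b))).
  apply: ler_wpM2r; first by rewrite invr_ge0 mulr_ge0// ltW.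
  by rewrite gerBl sqr_ge0.
(* The error at [b / q] is nonnegative, hence so is its upper bound. Cancelling the factor
   [D + delta] leaves [q * delta * (D - delta) <= 2 * b * g delta], and [D > tau * delta] turns this
   into the claim. *)
have := error_le_residual bq0 (xr_min bq0).
have := error_ge0 eta_ge0 (xr_min bq0).1 xdag_ell1.
set D := `|A _ - yd| in lo *; set E := error _ _ _ => E0 hE.
have {E E0 hE} h := le_trans E0 hE.
have tau10 : 0 < tau - 1 by rewrite subr_gt0.
rewrite ler_pdivrMr ?mulr_gt0// -mulrA ler_pdivlMl ?mulr_gt0//.
move: h; have -> : (delta ^+ 2 - D ^+ 2) / (2 * (b / q)) +
    (D / delta + 1) * g delta = ((D + delta) / (2 * b * delta)) *
    (q * (delta * delta - delta * D) + 2 * b * g delta).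
  by field; rewrite !gt_eqF.
rewrite pmulr_rge0; last first.
  by rewrite divr_gt0 ?mulr_gt0// ltr_wpDl// normr_ge0.
have : q * delta * (D - tau * delta) >= 0.
  by rewrite mulr_ge0 ?mulr_ge0 ?(ltW q0) ?(ltW delta_gt0)// subr_ge0 ltW.
nra.
Qed.

Lemma LEP_error_le q beta : 0 < q -> q < 1 ->
  LEP xdag eta xr q delta yd beta ->
  error eta (xr yd beta) xdag <= 85 / q * g delta.
Proof.
move=> q0 q1 [b0 [b00 start [[j _ betaE] adm] max]].
have grid_gt0 i : 0 < b0 / q ^+ i by rewrite divr_gt0// exprn_gt0.
have grid_lt (i k : nat) : (b0 / q ^+ i < b0 / q ^+ k) = (i < k)%N.
  by rewrite ltr_pM2l// ltf_pV2 ?posrE ?exprn_gt0// ltr_iXn2l.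
have grid_min i : ell1 (xr yd (b0 / q ^+ i)) := (xr_min (grid_gt0 i)).1.
(* The threshold at which [delta^2 / b] and [g delta] are equal. *)
pose bhat := delta ^+ 2 / g delta.
have bhat0 : 0 < bhat by rewrite divr_gt0// exprn_gt0.
have small b : 0 < b -> b <= bhat -> error eta (xr yd b) xdag <= Theta delta b.
  move=> b_gt0 bb; apply: (error_le_small_parameter b_gt0 (xr_min b_gt0)).
  by rewrite -ler_pdivlMr.
(* If already [b0 > bhat], then [n = 0] and the bound at [b0] is the starting
   condition of the rule. *)
have [n [hn1 hn2]] : exists n : nat, bhat < b0 / q ^+ n.+1 /\
    forall i, (i <= n)%N ->
      error eta (xr yd (b0 / q ^+ i)) xdag <= Theta delta (b0 / q ^+ i).
  have [N hN] : exists N : nat, bhat < b0 / q ^+ N.+1.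
    have : q ^+ k @[k --> \oo] --> 0 by apply: cvg_expr; rewrite gtr0_norm.
    move=> /cvgrPdist_lt/(_ _ (divr_gt0 b00 bhat0))[N _ hN].
    exists N; have := hN N.+1 (leqnSn N).
    rewrite sub0r normrN gtr0_norm ?exprn_gt0//.
    by rewrite ltr_pdivlMr// ltr_pdivlMr ?exprn_gt0// mulrC.
  have [n hn nmin] := ex_minnP (ex_intro (fun k => bhat < b0 / q ^+ k.+1) N hN).
  exists n; split=> // -[_|i ni]; first by rewrite expr0 divr1.
  apply: small => //; rewrite leNgt; apply/negP => /nmin.
  by rewrite leqNgt ni.
have Theta_ge0 b : 0 < b -> 0 <= Theta delta b.
  by move=> b_gt0; rewrite /Theta divr_ge0 ?mulr_ge0 ?sqr_ge0// ltW.
have Theta_anti b c : 0 < b -> b <= c -> Theta delta c <= Theta delta b.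
  move=> b_gt0 bc; have c_gt0 : 0 < c by exact: lt_le_trans bc.
  apply: ler_wpM2l; first by rewrite mulr_ge0 ?sqr_ge0.
  rewrite lef_pV2 ?posrE ?mulr_gt0//.
  by rewrite ler_pM2l.
pose b1 := b0 / q ^+ n.
(* Going through [xdag], the error between two such grid points is at most
   [2 * (Theta b' + Theta b1)]; as [Theta] decreases, this is at most [4 * Theta b'], the admissible
   bound. *)
have adm1 : lepskii_admissible eta xr q b0 delta yd b1.
  split; first by exists n.
  move=> _ [i _ <-] _; rewrite grid_lt => ni.
  apply: le_trans (error_quasi_triangle eta_ge0 (grid_min i) (grid_min n)
    xdag_ell1) _.
  rewrite (errorC eta xdag) /C_E.
  have := hn2 _ (ltnW ni); have := hn2 _ (leqnn n).
  have : Theta delta b1 <= Theta delta (b0 / q ^+ i).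
    by apply: Theta_anti => //; rewrite ltW// grid_lt.
  rewrite -/b1; move: (error _ _ _) (error _ _ _) (Theta _ _) (Theta _ _).
  move=> ? ? ? ?; lra.
(* Since [b1 / q > bhat], [Theta delta b1] is below [17 / (2 * q) * g delta], and ten times this
   constant is [85 / q]. *)
have Theta_b1 : 10 * Theta delta b1 <= 85 / q * g delta.
  have b1q : delta ^+ 2 < b1 / q * g delta.
    by rewrite -ltr_pdivrMr// /b1 -mulrA -invfM -exprSr.
  rewrite /Theta; have := grid_gt0 n; rewrite -/b1.
  move: b1 {adm1} b1q => b b1q b_gt0.
  rewrite mulrA ler_pdivrMr; last by rewrite mulr_gt0.
  have -> : 85 / q * g delta * (2 * b) = 170 * (b / q * g delta).
    by field; rewrite gt_eqF.
  lra.
apply: le_trans Theta_b1.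
have := max _ adm1; rewrite le_eqVlt => /predU1P[<-|b1b].
  have := hn2 _ (leqnn n); have := Theta_ge0 _ (grid_gt0 n); rewrite -/b1.
  by move: (error _ _ _) (Theta _ _) => ? ?; lra.
have b0b1 : b0 <= b1.
  by rewrite -[leLHS]divr1 -[X in b0 / X](expr0 q) leNgt grid_lt ltn0.
(* Admissibility of [beta] bounds its error to [b1] by [4 * Theta b1]; passing from [beta] to [xdag]
   via [b1] costs [2 * (4 + 1) = 10] times [Theta b1]. *)
have := adm b1 (ex_intro2 _ _ n I erefl) b0b1 b1b.
have cb : ell1 (xr yd beta) by rewrite -betaE.
have := error_quasi_triangle eta_ge0 cb xdag_ell1 (grid_min n).
rewrite (errorC _ (xr yd beta) (xr yd _)) /C_E -/b1.
have := hn2 _ (leqnn n); rewrite -/b1.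
move: (error _ _ _) (error _ _ _) (error _ _ _) (Theta _ _) => ? ? ? ?; lra.
Qed.

End convergence_rates.

(** * The variational inequality and the convergence rates *)

Theorem theorem2 (R : realType) (Y : completeNormedModType R)
  (ip : {dot Y for (@idfun R)}) (hip : induces_norm ip)
  (hY : infinite_dimensional Y)
  (A : {linear ell2 R -> Y}) (As : Y -> ell2 R)
  (A_bounded : bounded_operator A) (A_inj : injective A)
  (A_range : ~ closed (range A)) (A_adjoint : is_adjoint ip A As)
  (xdag : ell2 R) (xdag_ell1 : ell1 xdag) (y : Y) (hy : y = A xdag)
  (f : nat -> Y) (hf : forall k, As (f k) = ell2_unit R k)
  (eta : R) (eta_gt0 : 0 < eta) (K : R) (psi : R -> R)
  (h_notin : ~ range As xdag ->
     [/\ K = 2, index_function psi, concave_on_pos psi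
       & forall t, 0 < t -> psi_hat As xdag t <= psi t])
  (h_in : range As xdag ->
     [/\ forall t, 0 <= t -> psi t = t, 0 < K
       & distance_function As xdag K = 0]) :
  let g := fun t => 2 * eta * phi xdag f t + K * psi t in
  [/\ index_function g,
      concave_on_pos g,
      (forall x : ell2 R, ell1 x ->
         error eta x xdag <=
           penalty eta x - penalty eta xdag + g `|A (x - xdag)|)
    & forall xr : Y -> R -> ell2 R,
        (forall yd beta, 0 < beta ->
           is_tikhonov_minimizer A eta yd beta (xr yd beta)) ->
        (forall yd beta, 0 < beta ->
           `|xr yd beta - xdag| <= ell1_norm (xr yd beta - xdag)) /\
        forall rule : R -> Y -> R -> Prop,
          [\/ exists tau1 tau2 : R, [/\ 1 <= tau1, tau1 <= tau2
                & rule = TDP A xr tau1 tau2],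
              exists tau q beta0 : R, [/\ 1 < tau, 0 < q, q < 1, 0 < beta0
                & rule = SDP A xr tau q beta0]
            | exists q : R, [/\ 0 < q, q < 1
                & rule = LEP xdag eta xr q]] ->
          has_rate xr y rule (fun x => error eta x xdag) g /\
          has_rate xr y rule (fun x => ell1_norm (x - xdag))
            (fun t => phi xdag f t + psi t)].
Proof.
move=> g.
have f0 : f 0%N != 0 := source_neq0 A_adjoint (hf 0%N).
have phii := phi_index xdag_ell1 f0.
have phic : concave_on_pos (phi xdag f) by exact: phi_concave.
have [K0 psii psic l2] : [/\ 0 < K, index_function psi, concave_on_pos psi
    & forall x : ell2 R, 1 / 4 * `|x - xdag| ^+ 2 <=
        1 / 2 * `|x| ^+ 2 - 1 / 2 * `|xdag| ^+ 2 + K * psi `|A (x - xdag)|].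
  have [xin|xnotin] := pselect (range As xdag).
    have [psiE K0 dK] := h_in xin; split=> //.
    - exact: index_function_id.
    - exact: concave_on_pos_id.
    (* At radius [K] the distance vanishes, so [error2_le] leaves only the linear term. *)
    - move=> x; rewrite psiE//.
      have := error2_le hip A_adjoint xdag x (ltW K0).
      by rewrite dK expr0n/= add0r.
  have [-> psii psic psi_ge] := h_notin xnotin; split=> // x.
  have xdag0 : xdag != 0.
    apply/eqP => x0; apply: xnotin; exists 0 => //.
    by rewrite x0 (adjoint0 A_adjoint).
  (* [psi_hat] is controlled at positive arguments only; at 0, injectivity of [A] forces [x = xdag]
     and both sides vanish. *)
  have [Ah0|Ah_neq0] := eqVneq (A (x - xdag)) 0.
    have -> : x = xdag.
      apply/eqP; rewrite -subr_eq0; apply/eqP/A_inj.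
      by rewrite Ah0 linear0.
    have [psi0 _ _ _ _] := psii.
    by rewrite !subrr linear0 !normr0 psi0 expr0n/= !mulr0 addr0.
  have t0 : 0 < `|A (x - xdag)| by rewrite normr_gt0.
  (* At the balancing radius both terms of [error2_le] equal [psi_hat], which explains [K = 2]. *)
  have [r [r0 dr psir]] := psi_hatP hip A_adjoint A_bounded xdag0 t0.
  have := error2_le hip A_adjoint xdag x r0.
  have := psi_ge _ t0; rewrite dr psir; lra.
have eta2 : 0 < 2 * eta by rewrite mulr_gt0.
have gi : index_function g by exact: index_functionD.
have gc : concave_on_pos g by apply: concave_on_posD => //; exact: ltW.
have vi (x : ell2 R) : ell1 x -> error eta x xdag <=
    penalty eta x - penalty eta xdag + g `|A (x - xdag)|.
  move=> cx; rewrite /g /error /penalty.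
  have := l2 x.
  have := ler_wpM2l (ltW eta_gt0) (error1_le hip A_adjoint hf xdag_ell1 cx).
  lra.
split=> // xr xr_min; split=> [yd beta b0|rule hrule].
  apply: ell2_norm_le_ell1_norm; apply: ell1B => //.
  exact: (xr_min yd beta b0).1.
have eta_ge0 := ltW eta_gt0.
have [C C0 hC] : exists2 C : R, 0 <= C & forall delta yd beta, 0 < delta ->
    `|y - yd| <= delta -> rule delta yd beta ->
    error eta (xr yd beta) xdag <= C * g delta.
  rewrite hy; case: hrule => [[tau1 [tau2 [tau11 tau12 ->]]]
      |[tau [q [beta0 [tau1 q0 q1 b0 ->]]]]|[q [q0 q1 ->]]].
  - exists (tau2 + 1).
      by rewrite addr_ge0// (le_trans _ tau12)// (le_trans _ tau11).
    move=> delta yd beta d0 ydd.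
    exact: (TDP_error_le xdag_ell1 gi gc vi d0 ydd (xr_min yd) tau11).
  - exists ((q * (tau - 1))^-1 + (tau + 1)).
      have tau0 : 0 < tau by exact: lt_trans tau1.
      apply: addr_ge0; last by rewrite addr_ge0// ltW.
      by rewrite invr_ge0 mulr_ge0 ?subr_ge0// ltW.
    move=> delta yd beta d0 ydd.
    exact: (SDP_error_le eta_ge0 xdag_ell1 gi gc vi d0 ydd (xr_min yd) tau1 q0
      b0).
  - exists (85 / q); first by rewrite divr_ge0// ltW.
    move=> delta yd beta d0 ydd.
    exact: (LEP_error_le eta_ge0 xdag_ell1 gi gc vi d0 ydd (xr_min yd) q0 q1).
(* The second constant uses [g <= (2 * eta + K) * (phi + psi)] at [delta] and divides by the weight
   [eta] of the l^1 norm in the error. *)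
split; [exists C|exists (C * (2 * eta + K) / eta)].
  near=> delta => yd beta; apply: hC.
  by near: delta; exact: nbhs_right_gt.
near=> delta => yd beta yd_delta rb.
have delta0 : 0 < delta by near: delta; exact: nbhs_right_gt.
have hE := le_trans (ell1_norm_le_error eta _ _) (hC _ _ _ delta0 yd_delta rb).
rewrite mulrAC ler_pdivlMr// mulrC; apply: le_trans hE _.
rewrite -mulrA; apply: ler_wpM2l => //.
have := mulr_ge0 (ltW K0) (phi_ge0 f xdag_ell1 (ltW delta0)).
have := mulr_ge0 (ltW eta2) (index_function_ge0 psii (ltW delta0)).
rewrite /g; lra.
Unshelve. all: by end_near. Qed.
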